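(* Let $\mu_1$ and $\mu_2$ be two locally-valid MV assignments of the square grid crease pattern $G_{m,n}$. Then $\mu_1$ and $\mu_2$ are face-flippable. Moreover, if $c$ is a proper 2-vertex coloring, with colors purple and teal, of the graph $\overline{G^*}_{m,n}$ determined by $\mu_1,\mu_2$, then $\mu_1$ is turned into $\mu_2$ by flipping (once each) the faces of $G_{m,n}$ corresponding to all the vertices of $G^*_{m,n}$ that are colored purple by $c$; likewise $\mu_1$ is turned into $\mu_2$ by flipping the faces corresponding to all the vertices of $G^*_{m,n}$ that are colored teal by $c$.
   Context: Let $m,n\ge 1$. The square grid crease pattern $G_{m,n}$ is the subdivision of an $m\times n$ rectangle $P$ (the paper) into $mn$ unit squares (the faces). The creases (edges) of $G_{m,n}$ are the unit segments of the grid that are shared by two faces (segments on the boundary of $P$ are not creases); $E(G_{m,n})$ is the set of creases. The interior vertices are the $(m-1)(n-1)$ grid points in the interior of $P$; each is incident to exactly four creases. A mountain-valley (MV) assignment is a function $\mu:E(G_{m,n})\to\{-1,1\}$ ($1$ = mountain, $-1$ = valley). It is locally valid if at every interior vertex $v$ the sum of $\mu(e)$ over the four creases $e$ at $v$ equals $2$ or $-2$. Flipping a face $F$ under $\mu$ produces the MV assignment $\mu_F$ with $\mu_F(e)=-\mu(e)$ for every crease $e$ bordering $F$ and $\mu_F(e)=\mu(e)$ for all other creases. Two MV assignments are face-flippable if there is a finite sequence of faces whose successive flipping turns one into the other. The internal dual graph $G^*_{m,n}$ has one vertex for each face of $G_{m,n}$ and, for each crease $e$, an edge $e^*$ joining the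 two faces that share $e$. Given $\mu_1,\mu_2$, put $w(e^* )=|\mu_1(e)+\mu_2(e)|\in\{0,2\}$. The graph $\overline{G^*}_{m,n}$ is obtained from $G^*_{m,n}$ by subdividing each edge $e^*$ with $w(e^* )=2$ by one new vertex in its middle. This graph always admits a proper 2-vertex coloring. The vertices of $G^*_{m,n}$ are regarded as vertices of $\overline{G^*}_{m,n}$, so $c$ restricts to a (not necessarily proper) coloring of them. *)

(* Defs.v *)
From HB Require Import structures.
From mathcomp Require Import all_boot all_order all_algebra.

Set Implicit Arguments.
Unset Strict Implicit.
Unset Printing Implicit Defensive.

Import Order.TTheory GRing.Theory Num.Theory.
Local Open Scope ring_scope.

(* The rectangle P is [0, m] x [0, n]; the face (i, j) is the unit square
   [i, i+1] x [j, j+1]. *)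
Definition point (m n : nat) : finType := ('I_m.+1 * 'I_n.+1)%type.
Definition face (m n : nat) : finType := ('I_m * 'I_n)%type.

Definition corner (m n : nat) (p : point m n) (F : face m n) : bool :=
  ((p.1 == F.1 :> nat) || (p.1 == F.1.+1 :> nat)) &&
  ((p.2 == F.2 :> nat) || (p.2 == F.2.+1 :> nat)).

(* A unit segment is given by its endpoints, the left or lower one first, so
   that every geometric segment is represented exactly once. *)
Definition unit_segment (m n : nat) (s : point m n * point m n) : bool :=
  ((s.2.1 == s.1.1.+1 :> nat) && (s.2.2 == s.1.2 :> nat)) ||
  ((s.2.1 == s.1.1 :> nat) && (s.2.2 == s.1.2.+1 :> nat)).

Definition segment_borders (m n : nat) (s : point m n * point m n)
  (F : face m n) : bool := corner s.1 F && corner s.2 F.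

Definition is_crease (m n : nat) (s : point m n * point m n) : bool :=
  unit_segment s && (#|[set F | segment_borders s F]| == 2)%N.

Definition crease (m n : nat) : finType :=
  {s : point m n * point m n | is_crease s}.

Definition borders (m n : nat) (e : crease m n) (F : face m n) : bool :=
  segment_borders (val e) F.

Definition incident (m n : nat) (p : point m n) (e : crease m n) : bool :=
  (p == (val e).1) || (p == (val e).2).

Definition interior_vertex (m n : nat) (p : point m n) : bool :=
  (0 < p.1 < m)%N && (0 < p.2 < n)%N.

(* 1 is mountain, -1 is valley. *)
Definition mv_assignment (m n : nat) (mu : {ffun crease m n -> int}) : Prop :=
  forall e, mu e = 1 \/ mu e = -1.

Definition locally_valid (m n : nat) (mu : {ffun crease m n -> int}) : Prop :=
  forall p : point m n, interior_vertex p ->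
    \sum_(e : crease m n | incident p e) mu e = 2 \/
    \sum_(e : crease m n | incident p e) mu e = -2.

Definition flip (m n : nat) (mu : {ffun crease m n -> int}) (F : face m n) :
    {ffun crease m n -> int} :=
  [ffun e => if borders e F then - mu e else mu e].

Definition flips (m n : nat) (mu : {ffun crease m n -> int})
    (s : seq (face m n)) : {ffun crease m n -> int} :=
  foldl (@flip m n) mu s.

Definition face_flippable (m n : nat) (mu1 mu2 : {ffun crease m n -> int}) :
  Prop := exists s : seq (face m n), flips mu1 s = mu2.

(* The order in which the faces of A are flipped is arbitrary. *)
Definition turned_by_flipping (m n : nat) (mu1 mu2 : {ffun crease m n -> int})
    (A : {set face m n}) : Prop :=
  forall s : seq (face m n), perm_eq s (enum A) -> flips mu1 s = mu2.

(* The edge e^* of the internal dual graph joins F and F'. *)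
Definition dual_joins (m n : nat) (e : crease m n) (F F' : face m n) : bool :=
  [&& F != F', borders e F & borders e F'].

Definition weight (m n : nat) (mu1 mu2 : {ffun crease m n -> int})
  (e : crease m n) : int := `|mu1 e + mu2 e|.

(* Vertices of the subdivided dual graph: inl F is the dual vertex of F, and
   inr e is the new vertex in the middle of the edge e^* of weight 2. *)
Definition sub_vertex (m n : nat) (mu1 mu2 : {ffun crease m n -> int}) :
    finType :=
  (face m n + {e : crease m n | weight mu1 mu2 e == 2})%type.

Definition sub_adj (m n : nat) (mu1 mu2 : {ffun crease m n -> int}) :
    rel (sub_vertex mu1 mu2) :=
  fun x y =>
    match x, y with
    | inl F, inl F' =>
        [exists e, (weight mu1 mu2 e != 2) && dual_joins e F F']
    | inl F, inr e => borders (val e) F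
    | inr e, inl F => borders (val e) F
    | inr _, inr _ => false
    end.

Definition color : finType := bool.
Definition purple : color := true.
Definition teal : color := false.

Definition proper_coloring (V : finType) (adj : rel V) (c : V -> color) :
  Prop := forall x y : V, adj x y -> c x != c y.

Definition faces_colored (m n : nat) (mu1 mu2 : {ffun crease m n -> int})
    (c : sub_vertex mu1 mu2 -> color) (k : color) : {set face m n} :=
  [set F : face m n | c (inl F) == k].

(* Main.v *)
Require Import Defs.
From HB Require Import structures.
From mathcomp Require Import all_boot all_order all_algebra.
From mathcomp Require Import zify.

Set Implicit Arguments.
Unset Strict Implicit.
Unset Printing Implicit Defensive.

Import Order.TTheory GRing.Theory Num.Theory.
Local Open Scope ring_scope.

(** Let [d e] say whether [mu1] and [mu2] differ at [e].  Flipping the faces of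
    a set [A] turns [mu1] into [mu2] as soon as [d e] holds exactly when one of
    the two faces at [e] lies in [A], i.e. when [d] is the coboundary of the
    indicator of [A]; a proper coloring of the subdivided dual graph provides
    such an [A].  Unconditionally, an [A] exists because [d] is a cocycle: by
    local validity each assignment has an odd number of valleys around an
    interior vertex, so [d] holds for an even number of creases there, and [d]
    can be summed along the path that goes first right, then up, from the face
    [(0, 0)]. *)

(** * Flips as signs, and face sets whose coboundary is the disagreement set *)

Lemma flipsE (m n : nat) (mu : {ffun crease m n -> int}) (s : seq (face m n))
    (e : crease m n) :
  flips mu s e = (-1) ^+ count (@borders m n e) s * mu e.
Proof.
elim: s mu => [|F s IHs] mu /=; first by rewrite mul1r.
rewrite IHs ffunE exprD; case: (borders e F) => /=; last by rewrite mul1r.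
by rewrite expr1 mulN1r mulNr mulrN.
Qed.

Lemma crease_faces (m n : nat) (e : crease m n) :
  exists F F' : face m n,
    F != F' /\ forall G, borders e G = (G == F) || (G == F').
Proof.
have /andP [_ /cards2P [F [F' [neqFF' eqS]]]] := valP e.
exists F, F'; split=> // G.
by move/setP/(_ G): eqS; rewrite !inE.
Qed.

Lemma count_borders_enum (m n : nat) (A : {set face m n}) (e : crease m n)
    (F F' : face m n) :
    F != F' -> (forall G, borders e G = (G == F) || (G == F')) ->
  count (@borders m n e) (enum A) = ((F \in A) + (F' \in A))%N.
Proof.
move=> neqFF' bE.
rewrite -sum1_count big_enum_cond /= big_mkcondl /=.
rewrite (eq_bigl (fun G => G \in [set F; F'])); last first.
  by move=> G; rewrite bE !inE.
rewrite big_setU1 ?inE //= big_set1.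
by case: (F \in A); case: (F' \in A).
Qed.

(** A crease changes sign once for each of its two faces in the set, hence changes overall iff
    exactly one lies in it. Complementing [a] preserves [a F (+) a F'], so both values of [k] work;
    this serves purple and teal at once. *)
Lemma coboundary_turned_by_flipping (m n : nat)
    (mu1 mu2 : {ffun crease m n -> int}) (a : face m n -> bool) (k : bool) :
    mv_assignment mu1 -> mv_assignment mu2 ->
    (forall e F F', F != F' -> borders e F -> borders e F' ->
       (mu1 e != mu2 e) = a F (+) a F') ->
  turned_by_flipping mu1 mu2 [set F | a F == k].
Proof.
move=> mv1 mv2 da s /permP ps; apply/ffunP => e.
have [F [F' [neqFF' bE]]] := crease_faces e.
rewrite flipsE {s}ps (count_borders_enum _ neqFF' bE) !inE.
have := da e F F' neqFF'; rewrite !bE !eqxx orbT => /(_ isT isT).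
case: (mv1 e) => ->; case: (mv2 e) => ->;
  by case: (a F); case: (a F'); case: k.
Qed.

(** For values 1 and -1, weight 2 means agreement. Then the midpoint of the subdivided edge differs
    in color from both [F] and [F'], which therefore share a color; otherwise [F] and [F'] are
    adjacent and differ. *)
Lemma proper_coloring_coboundary (m n : nat)
    (mu1 mu2 : {ffun crease m n -> int}) (c : sub_vertex mu1 mu2 -> color)
    (e : crease m n) (F F' : face m n) :
    mv_assignment mu1 -> mv_assignment mu2 ->
    proper_coloring (@sub_adj m n mu1 mu2) c ->
    F != F' -> borders e F -> borders e F' ->
  (mu1 e != mu2 e) = c (inl F) (+) c (inl F').
Proof.
move=> mv1 mv2 pc neqFF' bF bF'.
have [w2 | wN2] := boolP (weight mu1 mu2 e == 2).
  have := pc (inl F) (inr (exist _ e w2)) bF.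
  have := pc (inl F') (inr (exist _ e w2)) bF'.
  move: w2 => /[dup]; rewrite {1}/weight.
  case: (mv1 e) => ->; case: (mv2 e) => -> //= _ w2;
    by case: (c (inl F)); case: (c (inl F')); case: (c (inr _)).
have adjFF' : sub_adj (inl F : sub_vertex mu1 mu2) (inl F').
  by apply/existsP; exists e; rewrite wN2 /dual_joins neqFF' bF bF'.
have := pc _ _ adjFF'; move: wN2; rewrite /weight.
case: (mv1 e) => ->; case: (mv2 e) => -> //= _;
  by case: (c (inl F)); case: (c (inl F')).
Qed.

(** The sum is 4 minus twice the number of valleys, so that number is 1 or 3. *)
Lemma odd_valleys (x y z t : int) :
    x = 1 \/ x = -1 -> y = 1 \/ y = -1 -> z = 1 \/ z = -1 -> t = 1 \/ t = -1 ->
    x + y + z + t = 2 \/ x + y + z + t = -2 ->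
  (x == -1) (+) (y == -1) (+) (z == -1) (+) (t == -1).
Proof. by case=> -> [] -> [] -> [] -> [] //. Qed.

(** * Coordinates for the creases and their positions relative to faces and vertices *)

Section Grid.

Variables m n : nat.

(** Indices are plain naturals to ease arithmetic; [inord] sends values out of range to 0, whence
    the bounds assumed below. *)
Definition vseg (i j : nat) : point m n * point m n :=
  ((inord i, inord j), (inord i, inord j.+1)).

Definition hseg (i j : nat) : point m n * point m n :=
  ((inord i, inord j), (inord i.+1, inord j)).

Lemma vseg_crease (i j : nat) :
  (0 < i < m)%N -> (j < n)%N -> is_crease (vseg i j).
Proof.
move=> hi hj.
have lt1 : (i.-1 < m)%N by lia.
have lt2 : (i < m)%N by lia.
rewrite /is_crease /unit_segment /= !inordK; try lia.
apply/andP; split; first lia.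
(* The faces to the left and to the right of the segment. *)
apply/cards2P; exists (Ordinal lt1, Ordinal hj), (Ordinal lt2, Ordinal hj).
split; first by rewrite xpair_eqE -!val_eqE /=; lia.
apply/setP => -[a b]; rewrite !inE !xpair_eqE -!val_eqE /=.
rewrite /segment_borders /corner /= !inordK; lia.
Qed.

Lemma hseg_crease (i j : nat) :
  (i < m)%N -> (0 < j < n)%N -> is_crease (hseg i j).
Proof.
move=> hi hj.
have lt1 : (j.-1 < n)%N by lia.
have lt2 : (j < n)%N by lia.
rewrite /is_crease /unit_segment /= !inordK; try lia.
apply/andP; split; first lia.
apply/cards2P; exists (Ordinal hi, Ordinal lt1), (Ordinal hi, Ordinal lt2).
split; first by rewrite xpair_eqE -!val_eqE /=; lia.
apply/setP => -[a b]; rewrite !inE !xpair_eqE -!val_eqE /=.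
rewrite /segment_borders /corner /= !inordK; lia.
Qed.

(** [e1], [e2], [e3], [e4] leave the vertex [(i, j)] upwards, downwards, to the right and to the
    left. *)
Lemma sum_incident (mu : crease m n -> int) (i j : nat)
    (e1 e2 e3 e4 : crease m n) :
    (0 < i < m)%N -> (0 < j < n)%N ->
    val e1 = vseg i j -> val e2 = vseg i j.-1 ->
    val e3 = hseg i j -> val e4 = hseg i.-1 j ->
  \sum_(e | incident (inord i, inord j) e) mu e =
    mu e1 + mu e2 + mu e3 + mu e4.
Proof.
move=> hi hj E1 E2 E3 E4.
rewrite (eq_bigl (fun e => e \in [:: e1; e2; e3; e4])); last first.
  move=> e; rewrite !inE -!val_eqE E1 E2 E3 E4 /incident.
  have /andP [+ _] := valP e.
  case: (val e) => -[a b] [a' b'].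
  rewrite /unit_segment /vseg /hseg !xpair_eqE -!val_eqE /= {E1 E2 E3 E4}.
  rewrite !inordK; [ | lia ..].
  by case/orP=> /andP [/eqP -> /eqP ->]; lia.
rewrite -big_uniq /=; first by rewrite !big_cons big_nil addr0 !addrA.
(* It remains to see that the four creases are distinct. *)
rewrite !inE -!val_eqE E1 E2 E3 E4 /vseg /hseg !xpair_eqE -!val_eqE /=.
clear E1 E2 E3 E4; rewrite !inordK; lia.
Qed.

(** The common crease is the left or bottom side of whichever face lies further right or up, so it
    starts at the lower left corner of that face. *)
Lemma borders_cases (e : crease m n) (F F' : face m n) :
    F != F' -> borders e F -> borders e F' ->
  [\/ [/\ F.2 = F'.2, F'.1 = F.1.+1 :> nat & val e = vseg F'.1 F'.2],
      [/\ F.2 = F'.2, F.1 = F'.1.+1 :> nat & val e = vseg F.1 F.2],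
      [/\ F.1 = F'.1, F'.2 = F.2.+1 :> nat & val e = hseg F'.1 F'.2] |
      [/\ F.1 = F'.1, F.2 = F'.2.+1 :> nat & val e = hseg F.1 F.2]].
Proof.
(* Along the crease, both endpoints are corners, which fixes the coordinate of the face; across it
   ([corner2]), two distinct faces touching the same grid line are consecutive. *)
have cornerS (a x : nat) : (a == x) || (a == x.+1) ->
  (a.+1 == x) || (a.+1 == x.+1) -> x = a by lia.
have corner2 (b y y' : nat) : y != y' ->
    (b == y) || (b == y.+1) -> (b == y') || (b == y'.+1) ->
  (y' = y.+1 /\ b = y') \/ (y = y'.+1 /\ b = y) by lia.
have inordE k l (u : 'I_k.+1) : u = l :> nat -> u = inord l.
  by move=> <-; rewrite inord_val.
rewrite /borders; have /andP [+ _] := valP e.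
case: (val e) F F' => -[a b] [a' b'] [x y] [x' y'].
rewrite /unit_segment /segment_borders /corner /vseg /hseg.
rewrite xpair_eqE -!val_eqE /= => /orP [] /andP [/eqP ha /eqP hb];
  rewrite ha hb negb_and => hne
    /andP [/andP [hx hy] /andP [hxS hyS]]
    /andP [/andP [hx' hy'] /andP [hxS' hyS']].
- have ex := cornerS _ _ hx hxS; have ex' := cornerS _ _ hx' hxS'.
  have xx' : x = x' by apply: val_inj; rewrite /= ex ex'.
  move: hne; rewrite xx' eqxx /= => hne.
  case: (corner2 _ _ _ hne hy hy') => -[yy' by_];
    [constructor 3 | constructor 4]; split=> //;
    congr (_, _); congr (_, _); apply: inordE; lia.
- have ey := cornerS _ _ hy hyS; have ey' := cornerS _ _ hy' hyS'.
  have yy' : y = y' by apply: val_inj; rewrite /= ey ey'.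
  move: hne; rewrite yy' eqxx orbF => hne.
  case: (corner2 _ _ _ hne hx hx') => -[xx' ax];
    [constructor 1 | constructor 2]; split=> //;
    congr (_, _); congr (_, _); apply: inordE; lia.
Qed.

(** * Integrating a cocycle modulo 2 on the grid *)

Section Potential.

Variable d : crease m n -> bool.

(** Extending [d] by [false] off the creases lets the sums below avoid range proofs. *)
Definition segval (s : point m n * point m n) : bool :=
  if insub s is Some e then d e else false.

Lemma segvalE (s : point m n * point m n) (e : crease m n) :
  val e = s -> segval s = d e.
Proof. by move=> <-; rewrite /segval valK. Qed.

Hypothesis cocycle : forall (i j : nat) (e1 e2 e3 e4 : crease m n),
  (0 < i < m)%N -> (0 < j < n)%N ->
  val e1 = vseg i j -> val e2 = vseg i j.-1 ->
  val e3 = hseg i j -> val e4 = hseg i.-1 j ->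
  d e1 (+) d e2 (+) d e3 (+) d e4 = false.

(** Passing from column [k] to [k.+1] crosses the grid line at abscissa [k.+1], and similarly for
    rows; hence the shifted indices. *)
Definition potential (i j : nat) : bool :=
  \big[addb/false]_(k < i) segval (vseg k.+1 0) (+)
  \big[addb/false]_(l < j) segval (hseg i l.+1).

Lemma potentialSr (i j : nat) :
  potential i j.+1 = potential i j (+) segval (hseg i j.+1).
Proof. by rewrite /potential big_ord_recr /= addbA. Qed.

(** In the bottom row this is the definition. Going up one row, the cocycle condition at the vertex
    [(i.+1, j.+1)], the common corner of the four faces involved, equates the two ways around it. *)
Lemma potentialSl (i j : nat) : (i.+1 < m)%N -> (j < n)%N ->
  potential i.+1 j = potential i j (+) segval (vseg i.+1 j).
Proof.
move=> hi; elim: j => [|j IHj] hj.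
  by rewrite /potential !big_ord0 big_ord_recr /= !addbF.
rewrite !potentialSr IHj; last exact: ltnW.
pose e1 : crease m n :=
  exist (fun s => is_crease s) _ (@vseg_crease i.+1 j.+1 hi hj).
pose e2 : crease m n :=
  exist (fun s => is_crease s) _ (@vseg_crease i.+1 j hi (ltnW hj)).
pose e3 : crease m n :=
  exist (fun s => is_crease s) _ (@hseg_crease i.+1 j.+1 hi hj).
pose e4 : crease m n :=
  exist (fun s => is_crease s) _ (@hseg_crease i j.+1 (ltnW hi) hj).
have := @cocycle i.+1 j.+1 e1 e2 e3 e4 hi hj erefl erefl erefl erefl.
rewrite -(@segvalE (vseg i.+1 j.+1) e1) // -(@segvalE (vseg i.+1 j) e2) //.
rewrite -(@segvalE (hseg i.+1 j.+1) e3) // -(@segvalE (hseg i j.+1) e4) //.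
by case: (potential _ _); case: (segval (vseg _ j.+1));
  case: (segval (vseg _ j)); case: (segval (hseg i _));
  case: (segval (hseg i.+1 _)).
Qed.

Lemma potential_coboundary (e : crease m n) (F F' : face m n) :
    F != F' -> borders e F -> borders e F' ->
  d e = potential F.1 F.2 (+) potential F'.1 F'.2.
Proof.
move=> neq bF bF'.
case: (borders_cases neq bF bF') => -[h1 h2 /segvalE <-].
(* Folding with [h2] turns the range condition into the bound carried by the ordinal [F'.1]. *)
- by rewrite h1 h2 potentialSl -?h2 // addKb.
- by rewrite h1 h2 potentialSl -?h2 // addbAC addbb.
- by rewrite h1 h2 potentialSr addKb.
- by rewrite h1 h2 potentialSr addbAC addbb.
Qed.

End Potential.

End Grid.

Lemma locally_valid_cocycle (m n : nat) (mu1 mu2 : {ffun crease m n -> int})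
    (i j : nat) (e1 e2 e3 e4 : crease m n) :
    mv_assignment mu1 -> mv_assignment mu2 ->
    locally_valid mu1 -> locally_valid mu2 ->
    (0 < i < m)%N -> (0 < j < n)%N ->
    val e1 = vseg m n i j -> val e2 = vseg m n i j.-1 ->
    val e3 = hseg m n i j -> val e4 = hseg m n i.-1 j ->
  (mu1 e1 != mu2 e1) (+) (mu1 e2 != mu2 e2) (+) (mu1 e3 != mu2 e3)
    (+) (mu1 e4 != mu2 e4) = false.
Proof.
move=> mv1 mv2 lv1 lv2 hi hj E1 E2 E3 E4.
have ip : interior_vertex (inord i : 'I_m.+1, inord j : 'I_n.+1).
  by rewrite /interior_vertex /= !inordK ?hi ?hj //; lia.
move: (lv1 _ ip) (lv2 _ ip).
rewrite !(sum_incident _ hi hj E1 E2 E3 E4).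
move=> /(odd_valleys (mv1 _) (mv1 _) (mv1 _) (mv1 _)) o1.
move=> /(odd_valleys (mv2 _) (mv2 _) (mv2 _) (mv2 _)) o2.
(* The parity of the disagreements is thus the sum of two odd valley counts. *)
have dE e : (mu1 e != mu2 e) = (mu1 e == -1) (+) (mu2 e == -1).
  by case: (mv1 e) => ->; case: (mv2 e) => ->.
by rewrite !dE; move: o1 o2;
  do 4 case: (mu1 _ == _); do 4 case: (mu2 _ == _).
Qed.

Theorem theorem3p4 (m n : nat) (hm : (1 <= m)%N) (hn : (1 <= n)%N)
    (mu1 mu2 : {ffun crease m n -> int})
    (mv1 : mv_assignment mu1) (mv2 : mv_assignment mu2)
    (valid1 : locally_valid mu1) (valid2 : locally_valid mu2) :
  face_flippable mu1 mu2 /\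
  (forall c : sub_vertex mu1 mu2 -> color,
     proper_coloring (@sub_adj m n mu1 mu2) c ->
     turned_by_flipping mu1 mu2 (faces_colored c purple) /\
     turned_by_flipping mu1 mu2 (faces_colored c teal)).
Proof.
split=> [|c pc]; last first.
  by split; apply: (coboundary_turned_by_flipping
      (a := fun F => c (inl F)) mv1 mv2) => e F F';
    apply: proper_coloring_coboundary.
(* With no coloring at hand, the potential of the disagreement set takes its place. *)
pose d (e : crease m n) := mu1 e != mu2 e.
pose a (F : face m n) := potential d F.1 F.2.
exists (enum [set F | a F == true]).
apply: (coboundary_turned_by_flipping mv1 mv2 _ (perm_refl _)) => e F F'.
apply: (potential_coboundary (d := d)) => i j e1 e2 e3 e4.
exact: locally_valid_cocycle.
Qed.
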